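(* Let $\Gamma$ be a weighted digraph with $n$ vertices and edge weights in a commutative ring. For each integer $r\ge 1$, let $c_r$ be the sum of the weights of all closed walks of length $r$ in $\Gamma$, and let $\ell_r=\sum_{\gamma\in L_r}(-1)^{c(\gamma)}w(\gamma)$, where $L_r$ is the set of all linear subdigraphs of $\Gamma$ of length $r$, $c(\gamma)$ is the number of cycles in $\gamma$, and $w(\gamma)$ is the weight of $\gamma$. Then the following identities hold. (1) For every integer $r>n$, $$c_r+c_{r-1}\ell_1+c_{r-2}\ell_2+\cdots+c_{r-n}\ell_n=0 .$$ (2) For every integer $r$ with $1\le r\le n$, $$c_r+c_{r-1}\ell_1+c_{r-2}\ell_2+\cdots+c_1\ell_{r-1}+r\,\ell_r=0 .$$
   Context: A weighted digraph $\Gamma$ is a finite directed graph (loops allowed, at most one edge for each ordered pair of vertices) in which every edge carries a weight in a commutative ring. A cycle is a directed cycle, viewed as a subgraph (with no distinguished starting vertex); a loop at a vertex is a cycle of length $1$. A linear subdigraph $\gamma$ of $\Gamma$ is a collection of pairwise vertex-disjoint cycles of $\Gamma$ (it need not cover all vertices). Its weight $w(\gamma)$ is the product of the weights of all its edges, $c(\gamma)$ is the number of cycles it contains, and its length is the number of edges in it. A walk from a vertex $u$ to a vertex $v$ is a sequence of vertices $u=x_0,x_1,\dots,x_k=v$ such that $(x_i,x_{i+1})$ is an edge for $i=0,\dots,k-1$; its length is $k$ and its weight is the product of the weights of the edges $(x_i,x_{i+1})$, counted with multiplicity. The walk is closed if $u=v$. A closed walk comes with its specified initial (equal to final) vertex,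 so closed walks traversing the same cycle from different starting vertices are different closed walks. *)

(* Defs.v *)
From HB Require Import structures.
From mathcomp Require Import all_boot all_order all_algebra.

Set Implicit Arguments.
Unset Strict Implicit.
Unset Printing Implicit Defensive.

Import GRing.Theory.
Local Open Scope ring_scope.

(* [weight u v] is only meaningful when [edge u v] holds: the sums [lsd_sum]
   and [closed_walk_sum] only involve its values on edges. *)
Record wdigraph (R : comPzRingType) (V : finType) := WDigraph {
  edge : rel V;
  weight : V -> V -> R
}.

Section WeightedDigraph.
Variables (R : comPzRingType) (V : finType) (G : wdigraph R V).

Definition edge_weight (a : V * V) : R := weight G a.1 a.2.

Definition cycle_edges (s : seq V) : {set V * V} := [set (x, next s x) | x in s].

(* A directed cycle is a set of edges, so that no starting vertex is
   distinguished. Its vertices are listed without repetition by [s], whence the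
   bound #|V| on the size of [s]. *)
Definition is_dicycle (C : {set V * V}) : bool :=
  [exists s : #|V|.-bseq V,
    [&& s != [::] :> seq V, ucycleb (edge G) s & C == cycle_edges s]].

Definition vertices (C : {set V * V}) : {set V} :=
  [set a.1 | a in C] :|: [set a.2 | a in C].

Definition linear_subdigraph (g : {set {set V * V}}) : bool :=
  [forall C in g, is_dicycle C] &&
  [forall C in g, forall D in g,
    (C != D) ==> [disjoint vertices C & vertices D]].

Definition lsd_weight (g : {set {set V * V}}) : R :=
  \prod_(a in cover g) edge_weight a.

Definition lsd_length (g : {set {set V * V}}) : nat := #|cover g|.

Definition lsd_sum (r : nat) : R :=
  \sum_(g : {set {set V * V}} | linear_subdigraph g && (lsd_length g == r))
    (-1) ^+ #|g| * lsd_weight g.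

(* For [i : 'I_k], [widen_ord (leqnSn k) i] and [lift ord0 i] are the elements
   of 'I_k.+1 with values i and i + 1. *)
Definition is_walk (k : nat) (x : {ffun 'I_k.+1 -> V}) : bool :=
  [forall i : 'I_k, edge G (x (widen_ord (leqnSn k) i)) (x (lift ord0 i))].

Definition is_closed_walk (k : nat) (x : {ffun 'I_k.+1 -> V}) : bool :=
  is_walk x && (x ord0 == x ord_max).

Definition walk_weight (k : nat) (x : {ffun 'I_k.+1 -> V}) : R :=
  \prod_(i < k) weight G (x (widen_ord (leqnSn k) i)) (x (lift ord0 i)).

Definition closed_walk_sum (r : nat) : R :=
  \sum_(x : {ffun 'I_r.+1 -> V} | is_closed_walk x) walk_weight x.

End WeightedDigraph.

(* Main.v *)
(* Let A be the weighted adjacency matrix. Then c_r = tr (A^r), and expanding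
   det (1 - t A) by Leibniz' formula over pairs (S, p), with p a permutation
   supported in S, shows that l_r is its coefficient of t^r: the orbits of p in S
   are the cycles of a linear subdigraph, and the sign of p is (-1)^|S| times
   (-1)^(number of cycles). By Jacobi's formula the derivative of
   P = det (1 - t A) is - tr (A adj (1 - t A)), while
   adj (1 - t A) (1 - t A) = P gives the coefficient of t^m in the adjugate as
   sum_(i <= m) l_i A^(m - i). Comparing coefficients of t^(r - 1) yields (2) for
   every r >= 1, and (1) follows because l_i = 0 for i > n. *)
Require Import Defs.
From HB Require Import structures.
From mathcomp Require Import all_boot all_order all_algebra fingroup perm.

Set Implicit Arguments.
Unset Strict Implicit.
Unset Printing Implicit Defensive.

Import GRing.Theory.
Local Open Scope ring_scope.

(** * Derivative of a determinant *)

Lemma deriv_prod (R : comNzRingType) (I : eqType) (r : seq I)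
    (F : I -> {poly R}) : uniq r ->
  (\prod_(i <- r) F i)^`()
  = \sum_(i <- r) (F i)^`() * \prod_(j <- r | j != i) F j.
Proof.
elim: r => [|a r IH]; first by rewrite !big_nil derivC.
case/andP=> ar ur; rewrite !big_cons derivM IH // eqxx /=; congr (_ * _ + _).
  rewrite [RHS]big_seq_cond [LHS]big_seq; apply: eq_bigl => j.
  by case: (boolP (j \in r)) => //= jr; rewrite (memPn ar).
rewrite mulr_sumr 2!big_seq; apply: eq_bigr => i ir.
by rewrite big_cons (memPnC ar) // mulrCA.
Qed.

(** Jacobi's formula: the product rule on the Leibniz terms differentiates one row at a time, and
    expanding along that row meets only cofactors of [M]. *)
Lemma deriv_det (R : comNzRingType) (n : nat) (M : 'M[{poly R}]_n) :
  (\det M)^`() = \sum_i \sum_j (M i j)^`() * cofactor M i j.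
Proof.
pose N i := \matrix_(k, l) if k == i then (M k l)^`() else M k l.
transitivity (\sum_i \det (N i)).
  rewrite exchange_big raddf_sum; apply: eq_bigr => s _ /=.
  rewrite -mulr_sumr derivM.
  have -> : ((-1) ^+ s : {poly R})^`() = 0.
    by case: (odd_perm s); rewrite ?derivN ?derivC ?oppr0.
  rewrite mul0r add0r deriv_prod ?index_enum_uniq //; congr (_ * _).
  apply: eq_bigr => i _; rewrite [RHS](bigD1 i) //= mxE eqxx.
  by congr (_ * _); apply: eq_bigr => j /negPf ji; rewrite mxE ji.
apply: eq_bigr => i _; rewrite (expand_det_row _ i); apply: eq_bigr => j _.
rewrite mxE eqxx; congr (_ * _); rewrite /cofactor; congr (_ * \det _).
by apply/matrixP=> k l; rewrite !mxE eq_sym (negPf (neq_lift _ _)).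
Qed.

(** * Newton's identities for [det (1 - t A)] *)

Section NewtonIdentities.
Variables (R : comNzRingType) (n : nat) (A : 'M[R]_n).

Definition rev_char_mx : 'M[{poly R}]_n := 1%:M - 'X *: map_mx polyC A.

Lemma rev_char_mxE i j : rev_char_mx i j = (i == j)%:R - (A i j)%:P * 'X.
Proof. by rewrite !mxE mulrC. Qed.

Let P := \det rev_char_mx.
Let B k : 'M[R]_n := \matrix_(i, j) (\adj rev_char_mx i j)`_k.

(* Compare coefficients in [adj (1 - t A) * (1 - t A) = det (1 - t A)]. *)
Lemma coef_adj_rev_char_mx m : B m = \sum_(i < m.+1) P`_i *: A ^+ (m - i).
Proof.
(* Coefficient of [t^k]: [P_k I = B_k - B_(k-1) A], with 0 in place of [B_(-1)]. Solved for [B_k],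
   this is the recurrence that the induction unrolls. *)
have adjE i j k : P`_k *+ (i == j)
    = B k i j - (if k is k'.+1 then (B k' *m A) i j else 0).
  have /matrixP/(_ i j) := mul_adj_mx rev_char_mx; rewrite -/P !mxE => E.
  rewrite -coefMn -E coef_sum.
  under eq_bigr => l _ do
    rewrite rev_char_mxE mulrBr coefB mulr_natr mulrA coefMX coefMC coefMn.
  rewrite sumrB (bigD1 j) //= eqxx big1 ?addr0; last by move=> l /negPf->.
  congr (_ - _); first by rewrite mxE.
  case: k => [|k] /=; first by rewrite big1.
  by rewrite [RHS]mxE; apply: eq_bigr => l _; rewrite [B _ _ _]mxE.
elim: m => [|m IH]; apply/matrixP=> i j.
  have := adjE i j 0%N; rewrite subr0 => <-.
  by rewrite big_ord1 mxE expr0 mxE mulr_natr.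
have /eqP := adjE i j m.+1; rewrite eq_sym subr_eq => /eqP->.
rewrite big_ord_recr /= subnn expr0 addrC [RHS]mxE.
congr (_ + _); first by rewrite !mxE mulr_natr.
rewrite IH mulmx_suml summxE summxE; apply: eq_bigr => l _.
by rewrite -scalemxAl subSn ?exprSr // -ltnS.
Qed.

Lemma newton_identity m :
  P`_m.+1 *+ m.+1 + \sum_(i < m.+1) P`_i * \tr (A ^+ (m.+1 - i)) = 0.
Proof.
rewrite -coef_deriv /P deriv_det -/P.
have -> : \sum_(i < m.+1) P`_i * \tr (A ^+ (m.+1 - i)) = \tr (A *m B m).
  rewrite coef_adj_rev_char_mx mulmx_sumr raddf_sum; apply: eq_bigr => i _ /=.
  by rewrite -scalemxAr mxtraceZ subSn ?exprS // -ltnS.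
(* The terms cancel entrywise: the [(i, j)] entry has derivative [- A i j], and its cofactor is the
   [(j, i)] entry of the adjugate. *)
rewrite coef_sum -big_split big1 // => i _ /=.
rewrite coef_sum !mxE -big_split big1 // => j _ /=.
rewrite rev_char_mxE mxE [\adj _ _ _]mxE derivB derivM derivX derivC mul0r.
by rewrite add0r mulr1 derivMn derivC mul0rn sub0r mulNr coefN coefCM addNr.
Qed.

End NewtonIdentities.

(** * Determinants indexed by a finite type *)

Lemma porbit_fconnect (T : finType) (p : {perm T}) (x y : T) :
  (y \in porbit p x) = fconnect p x y.
Proof.
apply/porbitP/idP => [[i ->]|]; first by rewrite permX fconnect_iter.
by move=> xy; exists (findex p x y); rewrite permX iter_findex.
Qed.

(** The bijection carries the orbits of [p] onto those of [q], and parity depends only on the number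
    of points and the number of orbits. *)
Lemma odd_perm_conj (T U : finType) (h : T -> U) (p : {perm T}) (q : {perm U}) :
  bijective h -> (forall x, q (h x) = h (p x)) -> odd_perm q = odd_perm p.
Proof.
move=> bij_h hpq; have inj_h := bij_inj bij_h; case: (bij_h) => h' _ h'K.
have porbit_h x : porbit q (h x) = h @: porbit p x.
  have expE i : (q ^+ i)%g (h x) = h ((p ^+ i)%g x).
    by elim: i => [|i IH]; rewrite ?expg0 ?perm1 // !expgSr !permM IH hpq.
  apply/setP=> y; apply/porbitP/imsetP => [[i ->]|[z /porbitP[i ->] ->]].
    by exists ((p ^+ i)%g x); rewrite ?expE // mem_porbit.
  by exists i; rewrite expE.
have porbits_h : porbits q = [set h @: X | X : {set T} in porbits p].
  apply/setP=> X; apply/imsetP/imsetP => [[y _ ->]|[_ /imsetP[x _ ->] ->]].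
    by exists (porbit p (h' y)); rewrite ?imset_f // -porbit_h h'K.
  by exists (h x); rewrite // porbit_h.
rewrite /odd_perm porbits_h card_imset; last exact: imset_inj.
by rewrite (bij_eq_card bij_h).
Qed.

Definition fun_mx (R : Type) (V : finType) (a : V -> V -> R) : 'M[R]_#|V| :=
  \matrix_(i, j) a (enum_val i) (enum_val j).

(** Conjugation by [enum_rank] matches the permutations of [V] with those of the matrix indices and
    keeps the sign. *)
Lemma det_fun_mx (R : comPzRingType) (V : finType) (M : V -> V -> R) :
  \det (fun_mx M)
  = \sum_(s : {perm V}) (-1) ^+ s * \prod_x M x (s x).
Proof.
have inj1 (s : {perm V}) : injective (fun i : 'I_#|V| => enum_rank (s (enum_val i))).
  by move=> i j /enum_rank_inj/perm_inj/enum_val_inj.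
have inj2 (s : 'S_#|V|) : injective (fun x => enum_val (s (enum_rank x))).
  by move=> i j /enum_val_inj/perm_inj/enum_rank_inj.
rewrite /determinant (reindex (fun s : {perm V} => perm (inj1 s))) /=.
  apply: eq_bigr => s _; congr (_ ^+ nat_of_bool _ * _).
    apply: (@odd_perm_conj _ _ enum_rank).
      by exists enum_val; [exact: enum_rankK | exact: enum_valK].
    by move=> x; rewrite permE enum_rankK.
  rewrite (reindex enum_rank) /=; last first.
    by exists enum_val => x _; [exact: enum_rankK | exact: enum_valK].
  by apply: eq_bigr => x _; rewrite mxE permE !enum_rankK.
exists (fun s => perm (inj2 s)) => s _; apply/permP=> x.
  by rewrite !permE /= ?permE !enum_rankK.
by rewrite !permE /= ?permE !enum_valK.
Qed.

(** * Coefficients of [det (1 - t A)] by supports *)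

Section SupportExpansion.
Variables (R : comNzRingType) (V : finType) (a : V -> V -> R).

(** [S] collects the indices whose factor contributes [- a x (s x) t], hence the power of [t]; at
    the others the factor [x == s x] kills every [s] not supported in [S]. *)
Lemma coef_det_rev_char_mx (r : nat) :
  (\det (rev_char_mx (fun_mx a)))`_r
  = \sum_(q : {set V} * {perm V} | perm_on q.1 q.2 && (#|q.1| == r))
      (-1) ^+ q.2 * (-1) ^+ #|q.1| * \prod_(x in q.1) a x (q.2 x).
Proof.
pose M u v : {poly R} := (u == v)%:R - (a u v)%:P * 'X.
have -> : rev_char_mx (fun_mx a)
    = fun_mx M.
  by apply/matrixP=> i j; rewrite rev_char_mxE !mxE /M (inj_eq enum_val_inj).
have termE (S : {set V}) (s : {perm V}) :
    \prod_x (if x \in S then - ((a x (s x))%:P * 'X) else (x == s x)%:R)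
    = ((perm_on S s)%:R * (-1) ^+ #|S| * \prod_(x in S) a x (s x))%:P * 'X^#|S|.
  rewrite (bigID (mem S)) /=.
  under eq_bigr => x xS do rewrite xS -mulNr -polyCN -mulN1r.
  rewrite big_split prodr_const -rmorph_prod big_split prodr_const /=.
  rewrite [X in _ * X](_ : _ = (perm_on S s)%:R); last first.
    case: (boolP (perm_on S s)) => [sS|/subsetPn[x]].
      by rewrite big1 // => x xS; rewrite (negPf xS) (out_perm sS) ?eqxx.
    rewrite inE => sx xS; rewrite (bigD1 x) //= (negPf xS) eq_sym (negPf sx).
    by rewrite mul0r.
  case: (perm_on S s); rewrite ?mulr1 ?mul1r ?mulr0 ?mul0r //.
rewrite det_fun_mx coef_sum [RHS]big_mkcond -(pair_bigA _ (fun S s =>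
  if perm_on S s && (#|S| == r) then
    (-1) ^+ s * (-1) ^+ #|S| * \prod_(x in S) a x (s x) else 0)).
rewrite exchange_big /=.
(* The summands are swapped so that the set chosen by [bigA_distr] is that of the terms in [t]. *)
apply: eq_bigr => s _; under eq_bigr => x _ do rewrite /M addrC.
rewrite bigA_distr mulr_sumr coef_sum; apply: eq_big => // S _.
rewrite termE -(rmorphN1 polyC) -rmorphXn mulrA -rmorphM coefCM coefXn eq_sym.
case: (perm_on S s); case: eqP => _ /=; rewrite ?(mulr1, mulr0, mul1r) //.
  by rewrite mulrA.
by rewrite !mul0r mulr0.
Qed.

End SupportExpansion.

(** * Closed walks and traces of matrix powers *)

Definition fun_cons (T : Type) (k : nat) (u : T) (y : {ffun 'I_k -> T}) :
    {ffun 'I_k.+1 -> T} :=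
  [ffun i => if unlift ord0 i is Some j then y j else u].

Lemma fun_cons0 (T : Type) (k : nat) (u : T) (y : {ffun 'I_k -> T}) :
  fun_cons u y ord0 = u.
Proof. by rewrite ffunE unlift_none. Qed.

Lemma fun_consS (T : Type) (k : nat) (u : T) (y : {ffun 'I_k -> T}) j :
  fun_cons u y (lift ord0 j) = y j.
Proof. by rewrite ffunE liftK. Qed.

(** Induction that splits off the first step. All vertex sequences are summed; taking [a] zero off
    the edges makes the non-walks vanish. *)
Lemma fun_mx_exp (R : comPzRingType) (V : finType) (a : V -> V -> R) (k : nat)
    (i j : 'I_#|V|) :
  (fun_mx a ^+ k) i j =
  \sum_(x : {ffun 'I_k.+1 -> V}
        | (x ord0 == enum_val i) && (x ord_max == enum_val j))
    \prod_(l < k) a (x (widen_ord (leqnSn k) l)) (x (lift ord0 l)).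
Proof.
elim: k i j => [|k IH] i j.
  rewrite expr0 mxE; have max0 : @ord_max 0 = ord0 by apply/val_inj.
  under eq_bigr => x _ do rewrite big_ord0.
  case: eqVneq => [->|ij].
    rewrite (big_pred1 [ffun=> enum_val j]) // => x; rewrite max0 andbb.
    apply/eqP/eqP => [x0|->]; last by rewrite ffunE.
    by apply/ffunP=> l; rewrite ffunE (ord1 l).
  rewrite big_pred0 // => x; rewrite max0; apply: contra_neqF ij.
  by case/andP=> /eqP-> /eqP/enum_val_inj.
rewrite exprS mxE.
(* Here [y] is what remains after the first step; its initial vertex is the summation index of the
   matrix product. *)
transitivity (\sum_(y : {ffun 'I_k.+1 -> V} | y ord_max == enum_val j)
  a (enum_val i) (y ord0)
  * \prod_(l < k) a (y (widen_ord (leqnSn k) l)) (y (lift ord0 l))).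
  rewrite (partition_big (fun y : {ffun _} => enum_rank (y ord0)) predT) //=.
  apply: eq_bigr => l _; rewrite mxE IH mulr_sumr; apply: eq_big => y.
    by rewrite andbC (can2_eq enum_rankK enum_valK).
  by case/andP=> /eqP->.
have lift_max : lift ord0 (@ord_max k) = ord_max by apply/val_inj.
rewrite [RHS](reindex_onto (fun_cons (enum_val i))
                (fun x => [ffun l => x (lift ord0 l)])) /=; last first.
  move=> x /andP[/eqP x0 _]; apply/ffunP=> l.
  by case: (unliftP ord0 l) => [l'|] ->; rewrite ?fun_cons0 // fun_consS ffunE.
apply: eq_big => y.
  rewrite fun_cons0 eqxx -lift_max fun_consS /=; case: eqP => //= _.
  by apply/esym/eqP/ffunP=> l; rewrite ffunE fun_consS.
move=> _; rewrite [RHS]big_ord_recl fun_consS; congr (a _ _ * _).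
  by rewrite (_ : widen_ord _ _ = ord0) ?fun_cons0 //; apply/val_inj.
apply: eq_bigr => l _; rewrite fun_consS.
rewrite (_ : widen_ord _ _ = lift ord0 (widen_ord (leqnSn k) l)) ?fun_consS //.
exact/val_inj.
Qed.

(** Zero off the edges, where [weight] is arbitrary, so that a sequence or permutation using a
    non-edge contributes nothing. *)
Definition adjacency (R : comPzRingType) (V : finType) (G : wdigraph R V)
    (u v : V) : R :=
  if edge G u v then weight G u v else 0.

Lemma closed_walk_sum_trace (R : comPzRingType) (V : finType)
    (G : wdigraph R V) (r : nat) :
  closed_walk_sum G r = \tr (fun_mx (adjacency G) ^+ r).
Proof.
rewrite /mxtrace; under eq_bigr => i _ do rewrite fun_mx_exp.
rewrite (exchange_big_dep predT) //= /closed_walk_sum big_mkcond.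
apply: eq_bigr => x _; rewrite /is_closed_walk andbC.
case: eqP => [x0 | x0] /=; last first.
  by rewrite big_pred0 // => i; apply/negP=> /andP[/eqP<- /eqP/esym].
rewrite (big_pred1 (enum_rank (x ord0))) => [|i]; last first.
  by rewrite -x0 andbb -(can2_eq enum_rankK enum_valK) eq_sym.
case: ifP => [/forallP walk_x | /negbT].
  by apply: eq_bigr => l _; rewrite /adjacency walk_x.
rewrite negb_forall => /existsP[l xl]; rewrite (bigD1 l) //= /adjacency.
by rewrite (negPf xl) mul0r.
Qed.

(** * Orbits of a permutation as directed cycles *)

Section ArcsOfPermutation.
Variables (V : finType) (p : {perm V}).

Definition arcs (X : {set V}) : {set V * V} := [set (y, p y) | y in X].

Lemma mem_arcs X x y : ((x, y) \in arcs X) = (x \in X) && (y == p x).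
Proof.
apply/imsetP/andP => [[z zX [-> ->]]|[xX /eqP->]]; first by rewrite zX eqxx.
by exists x.
Qed.

Lemma arcs_inj : injective arcs.
Proof.
move=> X Y XY; apply/setP=> x.
by have := mem_arcs X x (p x); rewrite XY mem_arcs eqxx !andbT.
Qed.

Lemma vertices_arcs_porbit x : vertices (arcs (porbit p x)) = porbit p x.
Proof.
apply/setP=> z; rewrite inE; apply/orP/idP => [|zx].
  case=> /imsetP[_ /imsetP[y yx ->] -> //=].
  by rewrite !porbit_fconnect in yx *; rewrite (connect_trans yx) ?fconnect1.
by left; apply/imsetP; exists (z, p z); rewrite // mem_arcs zx eqxx.
Qed.

(** On an [fcycle], [next] is [p] and the list runs through one orbit, so the two encodings of a
    cycle agree. *)
Lemma cycle_edges_fcycle (s : seq V) x :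
  fcycle p s -> x \in s -> cycle_edges s = arcs (porbit p x).
Proof.
move=> ps xs; apply/setP=> -[y z]; rewrite mem_arcs porbit_fconnect.
rewrite (fconnect_cycle ps xs).
apply/imsetP/andP => [[w ws [-> ->]]|[ys /eqP->]].
  by rewrite (nextE ps).
by exists y; rewrite // (nextE ps).
Qed.

(* The points outside [S] are the singleton orbits of [p]. *)
Lemma card_porbits_perm_on (S : {set V}) :
  perm_on S p -> #|porbits p| = (#|~: S| + #|[set porbit p x | x in S]|)%N.
Proof.
move=> pS; have fixS x : x \notin S -> porbit p x = [set x].
  move=> xS; apply/setP=> y; rewrite inE; apply/porbitP/eqP => [[i ->]|->].
    by elim: i => [|i IH]; rewrite ?perm1 // expgSr permM IH (out_perm pS).
  by exists 0%N; rewrite perm1.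
have <- : #|[set porbit p x | x in ~: S]| = #|~: S|.
  apply: card_in_imset => x y; rewrite !inE => xS yS.
  by rewrite !fixS // => /set1_inj.
(* The two families of orbits make up [porbits p] and do not meet: a common orbit would be a
   singleton outside [S] containing a point of [S]. *)
rewrite -cardsUI -imsetU setUC setUCr [X in (_ + X)%N](_ : _ = 0)%N.
  by rewrite addn0; apply: eq_card => X; apply/imsetP/imsetP=> -[x _ ->]; exists x.
apply/eqP; rewrite cards_eq0 -subset0; apply/subsetP=> X; rewrite inE.
case/andP=> /imsetP[x xS ->] /imsetP[y yS]; rewrite inE in xS.
by rewrite fixS // => xy; move: (porbit_id p y); rewrite -xy inE => /eqP yx;
  rewrite -yx yS in xS.
Qed.

End ArcsOfPermutation.

(** * Linear subdigraphs as permutations with a support *)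

Section LinearSubdigraphs.
Variables (R : comPzRingType) (V : finType) (G : wdigraph R V).

Lemma vertices_cycle_edges (s : seq V) : vertices (cycle_edges s) = [set x in s].
Proof.
apply/setP=> x; rewrite !inE; apply/orP/idP => [|xs].
  by case=> /imsetP[_ /imsetP[y ys ->] ->] /=; rewrite ?mem_next.
by left; apply/imsetP; exists (x, next s x); rewrite ?imset_f.
Qed.

Lemma is_dicycleP (C : {set V * V}) :
  reflect (exists s, [/\ s != [::], path.cycle (edge G) s, uniq s
                        & C = cycle_edges s])
          (is_dicycle G C).
Proof.
apply: (iffP existsP) => [[s /and3P[s0 /andP[cs us] /eqP->]]|].
  by exists (val s).
case=> s [s0 cs us ->].
have ss : (size s <= #|V|)%N by rewrite -(card_uniqP us) max_card.
by exists (Bseq ss); rewrite /= s0 /ucycleb cs us eqxx.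
Qed.

(** The set is kept beside the permutation because a fixed point is a loop when it lies in [q.1] and
    an uncovered vertex otherwise. *)
Definition perm_subdigraph (q : {set V} * {perm V}) : {set {set V * V}} :=
  [set arcs q.2 (porbit q.2 x) | x in q.1].

Definition edge_perms : {set {set V} * {perm V}} :=
  [set q | perm_on q.1 q.2 & [forall x in q.1, edge G x (q.2 x)]].

Lemma porbit_perm_on (S : {set V}) (p : {perm V}) x y :
  perm_on S p -> x \in S -> y \in porbit p x -> y \in S.
Proof.
move=> pS xS /porbitP[i ->]; elim: i => [|i IH]; first by rewrite perm1.
by rewrite expgSr permM (perm_closed _ pS).
Qed.

(** Yields the length [#|S|] and the weight as a product over [S]. *)
Lemma cover_perm_subdigraph S p : perm_on S p ->
  cover (perm_subdigraph (S, p)) = arcs p S.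
Proof.
move=> pS; apply/setP=> -[x y]; rewrite mem_arcs; apply/bigcupP/andP.
  case=> _ /imsetP[z zS ->]; rewrite mem_arcs => /andP[xz ->]; split=> //.
  exact: porbit_perm_on xz.
case=> xS /eqP->; exists (arcs p (porbit p x)); first exact: imset_f.
by rewrite mem_arcs porbit_id eqxx.
Qed.

Lemma perm_subdigraph_linear q :
  q \in edge_perms -> linear_subdigraph G (perm_subdigraph q).
Proof.
case: q => S p; rewrite inE /= => /andP[pS /'forall_implyP eS].
apply/andP; split; apply/'forall_implyP=> _ /imsetP[x xS ->].
  apply/is_dicycleP; exists (orbit p x).
  have fo := cycle_orbit (@perm_inj _ p) x.
  split; rewrite ?orbit_uniq //; last first.
    by rewrite (cycle_edges_fcycle fo (in_orbit _ x)).
    apply: cycle_from_next => [|y yx]; first exact: orbit_uniq.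
    rewrite (nextE fo) // eS // (porbit_perm_on pS xS) //.
    by rewrite porbit_fconnect fconnect_orbit.
  by rewrite -size_eq0 size_orbit -lt0n fingraph.order_gt0.
apply/'forall_implyP=> _ /imsetP[y yS ->]; apply/implyP=> xy.
rewrite !vertices_arcs_porbit; apply/pred0P=> z /=.
apply: contra_neqF xy => /andP[zx zy]; congr (arcs p _); apply/eqP.
by rewrite -eq_porbit_mem in zx; rewrite -eq_porbit_mem in zy;
  rewrite -(eqP zx) (eqP zy).
Qed.

(** The cover is the graph of [p] restricted to [S]; it determines [S] and [p] on [S], and [p] is
    the identity elsewhere. *)
Lemma perm_subdigraph_inj : {in edge_perms &, injective perm_subdigraph}.
Proof.
move=> [S p] [T q]; rewrite !inE /= => /andP[pS _] /andP[qT _] /(congr1 cover).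
rewrite !cover_perm_subdigraph // => /setP pq.
have ST : S = T.
  apply/setP=> x; have := pq (x, p x); have := pq (x, q x).
  by rewrite !mem_arcs !eqxx !andbT; case: (x \in S); case: (x \in T) => //= _ ->.
rewrite -ST in qT *; congr (_, _); apply/permP=> x.
case: (boolP (x \in S)) => [xS|xS]; last by rewrite !(out_perm _ xS).
by have := pq (x, p x); rewrite !mem_arcs -ST xS eqxx => /esym/eqP.
Qed.

(** The permutation follows the unique outgoing edge at each covered vertex and fixes all other
    vertices. *)
Lemma perm_subdigraph_surj g : linear_subdigraph G g ->
  exists2 q, q \in edge_perms & g = perm_subdigraph q.
Proof.
case/andP=> /'forall_implyP dg /'forall_implyP disj.
have cycle_of x y : (x, y) \in cover g -> exists s,
    [/\ path.cycle (edge G) s, uniq s, x \in s & cycle_edges s \in g].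
  case/bigcupP=> C Cg; have /is_dicycleP[s [_ cs us CE]] := dg _ Cg.
  rewrite CE in Cg *.
  by case/imsetP=> z zs [-> _]; exists s.
(* By disjointness, an edge of [g] with an end on the cycle [s] belongs to that cycle. *)
have coverE s x y : uniq s -> cycle_edges s \in g -> (x, y) \in cover g ->
    (x \in s) || (y \in s) -> x \in s /\ y = next s x.
  move=> us sg /bigcupP[D Dg xyD] xys.
  have DE : D = cycle_edges s.
    apply/eqP; apply: contraT => Ds.
    have /'forall_implyP/(_ _ sg)/implyP/(_ Ds)/pred0P := disj _ Dg.
    rewrite vertices_cycle_edges; case/orP: xys => [xs|ys].
      by move/(_ x)/negbT; rewrite /= !inE xs (imset_f fst xyD).
    by move/(_ y)/negbT; rewrite /= !inE ys (imset_f snd xyD) orbT.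
  by move: xyD; rewrite DE => /imsetP[z zs [-> ->]].
have cover_next s x : cycle_edges s \in g -> x \in s -> (x, next s x) \in cover g.
  by move=> sg xs; apply/bigcupP; exists (cycle_edges s); rewrite ?imset_f.
pose f x := if [pick y | (x, y) \in cover g] is Some y then y else x.
have fE s x : uniq s -> cycle_edges s \in g -> x \in s -> f x = next s x.
  rewrite /f => us sg xs; case: pickP => [y xy|/(_ (next s x))].
    by case: (coverE s x y) => //; rewrite xs.
  by rewrite cover_next.
pose S := [set x | [exists y, (x, y) \in cover g]].
have SP x : reflect (exists s, [/\ path.cycle (edge G) s, uniq s, x \in s
                                  & cycle_edges s \in g]) (x \in S).
  rewrite inE; apply: (iffP existsP) => [[y /cycle_of //]|[s [_ _ xs sg]]].
  by exists (next s x); apply: cover_next.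
have f_out x : x \notin S -> f x = x.
  rewrite /f inE => xS; case: pickP => // y xy.
  by case/existsP: xS; exists y.
have f_in x : (f x \in S) = (x \in S).
  case: (boolP (x \in S)) => [/SP[s [cs us xs sg]]|xS].
    by apply/SP; exists s; rewrite (fE s) // mem_next.
  by rewrite f_out // (negPf xS).
(* If [f x = f y] with [x] covered, then [y] is covered and its outgoing edge ends on the cycle of
   [x]; so [y] lies on that cycle, where [next] is injective. *)
have f_inj : injective f.
  move=> x y fxy; have := f_in x; rewrite fxy f_in.
  case: (boolP (x \in S)) => [xS|xS]; last first.
    by move/negbT=> yS; rewrite -(f_out x) // fxy f_out.
  case/SP: (xS) => s [cs us xs sg] yS; case/SP: (yS) => t [ct ut yt tg].
  have fxs := fE s x us sg xs; have fyt := fE t y ut tg yt.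
  have ys : y \in s.
    have yfy : (y, f y) \in cover g by rewrite fyt cover_next.
    by case: (coverE s y (f y)); rewrite // -fxy fxs mem_next xs orbT.
  by apply: (can_inj (prev_next us)); rewrite -fxs fxy (fE s).
exists (S, perm f_inj).
  rewrite inE /=; apply/andP; split.
    by apply/subsetP=> x; rewrite inE permE; apply: contraR => /f_out->.
  apply/'forall_implyP=> x /SP[s [cs us xs sg]].
  by rewrite permE (fE s) // next_cycle.
have cycleE s x : uniq s -> cycle_edges s \in g -> x \in s ->
    cycle_edges s = arcs (perm f_inj) (porbit (perm f_inj) x).
  move=> us sg xs; apply: cycle_edges_fcycle => //.
  by apply: cycle_from_next => // y ys; rewrite /= permE (fE s).
apply/setP=> C; apply/idP/imsetP => [Cg|[x /SP[s [cs us xs sg]] ->]]; last first.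
  by rewrite -(cycleE s).
have /is_dicycleP[[|x s] [] // _ cs us CE] := dg _ Cg; rewrite CE in Cg *.
exists x; last by apply: cycleE; rewrite ?mem_head.
by apply/SP; exists (x :: s); rewrite mem_head.
Qed.

(** The sign of [p] is -1 to the power [#|V|] plus the number of orbits; the singleton orbits
    outside [S] reduce this to [#|S|] plus the number of cycles. *)
Lemma sign_perm_subdigraph S p : perm_on S p ->
  (-1) ^+ #|perm_subdigraph (S, p)| = (-1) ^+ p * (-1) ^+ #|S| :> R.
Proof.
move=> pS; rewrite /perm_subdigraph imset_comp card_imset; last exact: arcs_inj.
rewrite -[LHS]signr_odd -[X in _ * X]signr_odd -signr_addb /odd_perm.
rewrite (card_porbits_perm_on pS) -(cardsC S) !oddD; congr (_ ^+ nat_of_bool _).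
by do 3!case: odd.
Qed.

(** Reindexing along the bijection with [edge_perms]; the further pairs on the right use a non-edge
    and contribute 0. *)
Lemma lsd_sum_perms (r : nat) :
  lsd_sum G r
  = \sum_(q : {set V} * {perm V} | perm_on q.1 q.2 && (#|q.1| == r))
      (-1) ^+ q.2 * (-1) ^+ #|q.1| * \prod_(x in q.1) adjacency G x (q.2 x).
Proof.
transitivity (\sum_(g in perm_subdigraph @: [set q in edge_perms | #|q.1| == r])
  (-1) ^+ #|g| * lsd_weight G g).
  apply: eq_bigl => g; apply/andP/imsetP => [[lg /eqP <-]|[[S p]]].
    have [[S p] pS ->] := perm_subdigraph_surj lg.
    exists (S, p); rewrite // inE pS /lsd_length cover_perm_subdigraph /=.
      by rewrite card_imset // => x y [].
    by move: pS; rewrite inE => /andP[].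
  rewrite inE => /andP[ep /= /eqP <-] ->; rewrite perm_subdigraph_linear //.
  rewrite /lsd_length cover_perm_subdigraph; last by move: ep; rewrite inE => /andP[].
  by rewrite card_imset // => x y [].
rewrite big_imset /=; last first.
  by move=> q q'; rewrite !inE => /andP[? _] /andP[? _]; apply: perm_subdigraph_inj;
     rewrite inE.
rewrite big_mkcond [RHS]big_mkcond; apply: eq_bigr => -[S p] _.
rewrite !inE /=; case: (boolP (perm_on S p)) => //= pS.
case: (#|S| == r); rewrite ?andbF ?andbT //.
case: ifP => [/'forall_implyP eS|/negbT].
  rewrite sign_perm_subdigraph // /lsd_weight cover_perm_subdigraph //.
  rewrite big_imset => [|x y _ _ [] //]; congr (_ * _).
  by apply: eq_bigr => x xS; rewrite /adjacency eS.
rewrite negb_forall => /existsP[x]; rewrite negb_imply => /andP[xS xp].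
by rewrite (bigD1 x) //= /adjacency (negPf xp) mul0r mulr0.
Qed.

(** Only the empty subdigraph has length 0; this term becomes the leading [c_r]. *)
Lemma lsd_sum0 : lsd_sum G 0 = 1.
Proof.
rewrite lsd_sum_perms (big_pred1 (set0, 1%g)) /=.
  by rewrite odd_perm1 cards0 big_set0 !mulr1.
case=> S p; rewrite /= -pair_eqE /= cards_eq0 andbC.
case: eqVneq => //= ->; apply/idP/eqP => [pS|->]; last exact: perm_on1.
by apply: (perm_on_id pS); rewrite cards0.
Qed.

Lemma lsd_sum_gt (r : nat) : (#|V| < r)%N -> lsd_sum G r = 0.
Proof.
move=> Vr; rewrite lsd_sum_perms big_pred0 // => q.
by rewrite ltn_eqF ?andbF // (leq_ltn_trans (max_card _)).
Qed.

End LinearSubdigraphs.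

(** * The identities between closed walks and linear subdigraphs *)

Lemma closed_walk_lsd_identity (R : comPzRingType) (V : finType)
    (G : wdigraph R V) (m : nat) :
  lsd_sum G m.+1 *+ m.+1
  + \sum_(i < m.+1) closed_walk_sum G (m.+1 - i) * lsd_sum G i = 0.
Proof.
(* Polynomials require 1 != 0 in the coefficient ring. *)
have [R0|R1] := eqVneq (1 : R) 0; first by rewrite -[LHS]mulr1 R0 mulr0.
pose R' : comNzRingType :=
  HB.pack (R : Type) (GRing.PzSemiRing_isNonZero.Build R R1)
          (GRing.ComPzRing.on R).
(* Destructing [R] makes the ring structures of [R] and [R'] convertible. *)
case: R G R1 @R' => T c G R1 R'.
have := @newton_identity R' _ (fun_mx (@adjacency R' V G)) m.
rewrite coef_det_rev_char_mx -lsd_sum_perms.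
under eq_bigr => i _ do
  rewrite coef_det_rev_char_mx -lsd_sum_perms -closed_walk_sum_trace mulrC.
exact.
Qed.

Theorem theorem2p1 (R : comPzRingType) (V : finType) (G : wdigraph R V)
    (n : nat) (hn : #|V| = n) :
  (forall r : nat, (n < r)%N ->
     closed_walk_sum G r
     + \sum_(1 <= i < n.+1) closed_walk_sum G (r - i) * lsd_sum G i = 0)
  /\
  (forall r : nat, (1 <= r <= n)%N ->
     closed_walk_sum G r
     + \sum_(1 <= i < r) closed_walk_sum G (r - i) * lsd_sum G i
     + lsd_sum G r *+ r = 0).
Proof.
(* Splitting off the term [i = 0] gives the form of (2) for every positive [r], including
   [r > n]. *)
have identity r : (0 < r)%N -> closed_walk_sum G r
    + \sum_(1 <= i < r) closed_walk_sum G (r - i) * lsd_sum G i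
    + lsd_sum G r *+ r = 0.
  case: r => // m _; rewrite -[RHS](closed_walk_lsd_identity G m) addrC.
  by rewrite -(big_mkord predT (fun i => closed_walk_sum G (m.+1 - i)
    * lsd_sum G i)) [in RHS]big_nat_recl // lsd_sum0 mulr1 subn0 big_add1.
split=> [r nr|r /andP[r0 _]]; last exact: identity.
have := identity r (leq_ltn_trans (leq0n n) nr).
(* For [r > n] the last term and all summands with [i > n] vanish, which leaves (1). *)
rewrite (lsd_sum_gt G) ?hn // mul0rn addr0 (@big_cat_nat _ _ _ n.+1) //.
rewrite [X in _ + (_ + X)]big_nat_cond [X in _ + (_ + X)]big1 ?addr0 // => i.
by rewrite andbT => /andP[ni _]; rewrite (lsd_sum_gt G) ?hn ?mulr0.
Qed.
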